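(* Let $\rho<0$ and $\gamma>0$. Let $X$ and $Y$ be nonnegative random variables, where the support of $X$ has upper endpoint $\beta(\infty)>0$. Let $\alpha\in RV_\rho$ and $a\in RV_\gamma$ be positive functions such that $t\,\mathbb P[Y/a(t)>y]\to y^{-1/\gamma}$ for every $y>0$, and suppose there is a non-null Radon measure $\mu$ on $[0,\infty]\times(0,\infty]$ with $$t\,\mathbb P\left[\left(\frac{\beta(\infty)-X}{\alpha(t)},\frac{Y}{a(t)}\right)\in\cdot\right]\xrightarrow{\ \mathrm v\ }\mu(\cdot)\quad\text{in } M_+([0,\infty]\times(0,\infty]),$$ and such that for each $y>0$, $x\mapsto\mu([0,x]\times(y,\infty])$ is a nondegenerate distribution function. Then $XY$ has a regularly varying tail of index $-1/\gamma$, and for all $z>0$, $$t\,\mathbb P\left[\frac{XY}{a(t)}>z\right]\to z^{-1/\gamma}\beta(\infty)^{1/\gamma}\quad\text{as } t\to\infty.$$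
   Context: $RV_c$ denotes the class of positive measurable functions $f$ with $f(tx)/f(x)\to t^c$ as $x\to\infty$ for all $t>0$; a random variable $W$ has a regularly varying tail of index $-c$ if $\mathbb P[W>\cdot]\in RV_{-c}$. Vague convergence in $M_+(\mathsf S)$ means convergence on relatively compact continuity sets of the limit. *)

(* Defs.v *)
From HB Require Import structures.
From mathcomp Require Import all_boot all_order all_algebra.
From mathcomp Require Import all_classical all_reals all_analysis measurable_realfun.
Set Implicit Arguments. Unset Strict Implicit. Unset Printing Implicit Defensive.
Import Order.TTheory GRing.Theory Num.Theory.
Import numFieldNormedType.Exports.
Local Open Scope classical_set_scope.
Local Open Scope ring_scope.

Definition RV {R : realType} (c : R) (f : R -> R) : Prop :=
  (forall x, 0 < x -> 0 < f x) /\ measurable_fun setT f /\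
  forall t, 0 < t -> (fun x => f (t * x) / f x) x @[x --> +oo] --> t `^ c.

Definition Espace (R : realType) : set (\bar R * \bar R) :=
  [set p | (0 <= p.1)%E /\ (0 < p.2)%E].

Definition rel_boundary {R : realType} (E A : set (\bar R * \bar R)) :=
  E `&` closure A `&` closure (E `\` A).

Definition rel_compact {R : realType} (E A : set (\bar R * \bar R)) :=
  exists K, [/\ compact K, K `<=` E & A `<=` K].

Definition radon_on {R : realType}
  (mu : {measure set (\bar R * \bar R) -> \bar R}) (E : set (\bar R * \bar R)) :=
  mu (~` E) = 0%E /\
  forall K, compact K -> K `<=` E -> (mu K < +oo)%E.

Definition vague_cvg {R : realType} (E : set (\bar R * \bar R))
  (nu : R -> set (\bar R * \bar R) -> \bar R)
  (mu : {measure set (\bar R * \bar R) -> \bar R}) :=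
  forall A, measurable A -> A `<=` E -> rel_compact E A ->
    mu (rel_boundary E A) = 0%E ->
    nu t A @[t --> +oo] --> mu A.

(* F : \bar R -> \bar R (considered on [0,oo]) is a (not necessarily
   normalised) nondegenerate distribution function: finite on [0,oo),
   nondecreasing, right-continuous, F(x) -> F(+oo) as x -> oo (no mass at
   +oo), and not a single jump (not concentrated at one point). *)
Definition nondeg_distribution_fun {R : realType} (F : \bar R -> \bar R) :=
  [/\ (forall x : R, 0 <= x -> (F x%:E < +oo)%E),
      (forall x y : R, 0 <= x -> x <= y -> (F x%:E <= F y%:E)%E),
      (forall x : R, 0 <= x -> F y%:E @[y --> x^'+] --> F x%:E),
      F x%:E @[x --> +oo] --> F +oo%E &
      ~ exists (x0 : R) (c : \bar R),
          forall x : R, 0 <= x -> F x%:E = (if x < x0 then 0%E else c)].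

Definition upper_endpoint {d} {T : measurableType d} {R : realType}
  (P : probability T R) (X : T -> R) : \bar R :=
  ereal_sup [set x%:E | x in [set x : R | (0%E < P [set w | (x < X w)%R])%E]].

(* Main.v *)
(** Since [X <= beta] almost surely, [X Y > z a(t)] implies [beta Y > z a(t)];
    conversely [Y > y a(t)] with [X > b], for [b < beta] close to [beta], implies
    [X Y > b y a(t)]. So the limit reduces to
    [t P(X <= b, Y > y a(t)) -> 0] for every [b < beta]. Rescaling, this event lies in
    a corner [[m, oo] x [z, oo]] as soon as [alpha(t) <= (beta - b) / m], and the corner
    has small limit mass for [m] large because [mu] puts no mass on [{oo} x (z, oo]].
    Neither [alpha(t) -> 0] nor a comparison of [a(s)] with [a(t)] is drawn from the
    uniform convergence theorem for regularly varying functions: [alpha(2^n) -> 0] is a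
    ratio test, and the gap between consecutive powers of 2 is filled using
    [c a(s) <= a(t)] for large [s <= t], which the scaling of the tail of [Y] forces.
    Regular variation of the tail [H] of [X Y] follows by taking [t = 1 / H(x)]. *)
Require Import Defs.
From HB Require Import structures.
From mathcomp Require Import all_boot all_order all_algebra.
From mathcomp Require Import all_classical all_reals all_analysis measurable_realfun.
From mathcomp Require Import lra.
Import Order.TTheory GRing.Theory Num.Theory.
Import numFieldNormedType.Exports.
Local Open Scope classical_set_scope.
Local Open Scope ring_scope.

(** * Compactness of the extended line, and slices of null measure *)

(** The extended line is the image of [[-1, 1]] under [expand]; continuity is immediate, as extended
    balls are measured through [contract], which [expand] inverts. *)
Lemma compact_ereal (R : realType) : compact [set: \bar R].
Proof.
have -> : [set: \bar R] = @expand R @` `[-1, 1].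
  rewrite eqEsubset; split => // x _; exists (contract x); last exact: contractK.
  by rewrite /= in_itv/= -ler_norml contract_le1.
apply: continuous_compact; last exact: segment_compact.
apply/subspace_continuousP => x; rewrite /= in_itv/= -ler_norml => x1.
apply/cvg_ballP => e e0; rewrite near_withinE; near=> y.
rewrite /= in_itv/= -ler_norml => y1.
rewrite /ball/= /ereal_ball (expandK x1) (expandK y1).
by near: y; exact: (nbhsx_ballx x e e0).
Unshelve. all: by end_near. Qed.

(** Slices at distinct heights are disjoint inside [B], so only finitely many have mass at least
    [1 / (n + 1)]. The charged heights thus form a countable, hence Lebesgue-null, set, which cannot
    contain []a, b[]. *)
Lemma exists_null_slice d (T : measurableType d) (R : realType)
    (mu : {measure set T -> \bar R}) (B : set T) (f : T -> \bar R) (a b : R) :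
  measurable B -> (mu B < +oo)%E -> measurable_fun setT f -> a < b ->
  exists2 r : R, a < r < b & mu (B `&` f @^-1` [set r%:E]) = 0%E.
Proof.
move=> mB muB mf ab; pose S r := B `&` f @^-1` [set r%:E].
have mS r : measurable (S r).
  by apply: measurableI => //; rewrite -[X in measurable X]setTI; exact: mf.
apply: contrapT => noslice.
have finS n : finite_set [set r : R | ((n.+1%:R^-1)%:E <= mu (S r))%E].
  apply: contrapT.
  (* [N] disjoint slices of mass at least [1 / (n + 1)] would outweigh [B]. *)
  have [N hN] : exists N : nat, (mu B < (N%:R * n.+1%:R^-1)%:E)%E.
    have fB : mu B \is a fin_num by rewrite ge0_fin_numE.
    exists (Num.truncn (fine (mu B) * n.+1%:R)).+1.
    rewrite -[X in (X < _)%E](fineK fB) lte_fin ltr_pdivlMr//.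
    exact: truncnS_gt.
  move=> /(@infinite_set_fset _ _ N)[A subA NA].
  suff : (mu B <= mu B /\ (N%:R * n.+1%:R^-1)%:E <= mu B)%E.
    by move=> [_]; rewrite leNgt hN.
  split=> //.
  apply: (@le_trans _ _ (mu (\big[setU/set0]_(i <- finmap.enum_fset A) S i))); last first.
    apply: le_measure; rewrite ?inE//.
      by apply: bigsetU_measurable => i _; exact: mS.
    by rewrite -bigcup_fset => x [i _ []].
  rewrite measure_fbigsetU//; last first.
    move=> i j _ _ [x [[_ xi] [_ xj]]].
    by have [] : i%:E = j%:E :> \bar R by rewrite -xi -xj.
  apply: (@le_trans _ _ (\sum_(i <- finmap.enum_fset A) (n.+1%:R^-1)%:E)%E).
    rewrite sumEFin lee_fin big_const_seq count_predT iter_addr_0.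
    by rewrite -[leRHS]mulr_natl ler_wpM2r// ler_nat.
  rewrite big_seq [leRHS]big_seq; apply: lee_sum => i iA; exact: subA.
have cnt : countable (\bigcup_n [set r : R | ((n.+1%:R^-1)%:E <= mu (S r))%E]).
  by apply: bigcup_countable => // n _; exact: finite_set_countable.
have := countable_lebesgue_measure0 cnt.
apply/eqP; rewrite gt_eqF//.
apply: (@lt_le_trans _ _ (lebesgue_measure `]a, b[%classic)).
  by rewrite lebesgue_measure_itv/= lte_fin ab -EFinB lte_fin subr_gt0.
apply: le_outer_measure => r /=; rewrite in_itv/= => rab.
have Sr0 : (0 < mu (S r))%E.
  by rewrite lt0e measure_ge0 andbT; apply/eqP => h; apply: noslice; exists r.
have [fS|] := boolP (mu (S r) \is a fin_num); last first.
  rewrite ge0_fin_numE// -leNgt leye_eq => /eqP Sroo.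
  by exists 0%N => //=; rewrite -/(S r) Sroo leey.
exists (Num.truncn (fine (mu (S r)))^-1) => //=.
have fS0 : 0 < fine (mu (S r)) by rewrite -lte_fin fineK.
rewrite -/(S r) -[leRHS](fineK fS) lee_fin invf_ple ?posrE//.
exact/ltW/truncnS_gt.
Unshelve. all: by end_near. Qed.

(** * Corners of the extended quadrant as continuity sets *)

Lemma closed_fst_preimage (S T : topologicalType) (A : set S) :
  closed A -> closed [set p : S * T | A p.1].
Proof.
by move=> cA; apply: (@preimage_closed _ _ (@fst S T)) => // x _; exact: cvg_fst.
Qed.

Lemma closed_snd_preimage (S T : topologicalType) (A : set T) :
  closed A -> closed [set p : S * T | A p.2].
Proof.
by move=> cA; apply: (@preimage_closed _ _ (@snd S T)) => // x _; exact: cvg_snd.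
Qed.

Lemma measurable_fst_preimage (R : realType) (A : set (\bar R)) :
  measurable A -> measurable [set p : \bar R * \bar R | A p.1].
Proof. by move=> mA; rewrite -[X in measurable X]setTI; exact: measurable_fst. Qed.

Lemma measurable_snd_preimage (R : realType) (A : set (\bar R)) :
  measurable A -> measurable [set p : \bar R * \bar R | A p.2].
Proof. by move=> mA; rewrite -[X in measurable X]setTI; exact: measurable_snd. Qed.

(** The points at infinity are included, so this is closed in a compact square; for [0 <= m] and
    [0 < y] it lies in [Espace], hence is a candidate test set for vague convergence. *)
Definition corner {R : realType} (m y : R) : set (\bar R * \bar R) :=
  [set p | (m%:E <= p.1)%E] `&` [set p | (y%:E <= p.2)%E].

Lemma measurable_ereal_ge (R : realType) (y : \bar R) : measurable [set x | (y <= x)%E].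
Proof. by rewrite -set_itvcy; exact: emeasurable_itv. Qed.

Lemma measurable_corner (R : realType) (m y : R) : measurable (corner m y).
Proof.
apply: measurableI.
  exact: (measurable_fst_preimage _ [set x | (m%:E <= x)%E] (measurable_ereal_ge _ _)).
exact: (measurable_snd_preimage _ [set x | (y%:E <= x)%E] (measurable_ereal_ge _ _)).
Qed.

Lemma compact_corner (R : realType) (m y : R) : compact (corner m y).
Proof.
apply: (@compact_setX _ _ [set x | (m%:E <= x)%E] [set x | (y%:E <= x)%E]);
  by apply: (subclosed_compact (@closed_ereal_le_ereal R _) (compact_ereal R)).
Qed.

Lemma EFin_cvg (R : realFieldType) (x : R) : z%:E @[z --> x] --> x%:E.
Proof. by apply/fine_cvgP; split; [exact: nearW|exact: cvg_id]. Qed.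

(** Only the two finite edges count: lowering the coordinate that meets its bound leaves the corner,
    and positivity of [m] and [y] keeps the approximating points inside [Espace]. *)
Lemma rel_boundary_corner (R : realType) (m y : R) : 0 < m -> 0 < y ->
  rel_boundary (@Espace R) (corner m y) =
    corner m y `&` ([set p | p.1 = m%:E] `|` [set p | p.2 = y%:E]).
Proof.
move=> m0 y0; rewrite eqEsubset; split=> p.
  move=> [[_ clp] clEp].
  have cp : corner m y p.
    suff : closed (corner m y) by move/closure_id => ->.
    apply: closedI.
      exact: (closed_fst_preimage _ _ [set x | (m%:E <= x)%E] (@closed_ereal_le_ereal R _)).
    exact: (closed_snd_preimage _ _ [set x | (y%:E <= x)%E] (@closed_ereal_le_ereal R _)).
  split=> //; case: cp => /= mp yp.
  (* Off the corner some coordinate is below its bound, and the union of the two closed half-planes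
     passes to the closure. *)
  have [/= pm|/= py] : ([set p | (p.1 <= m%:E)%E] `|` [set p | (p.2 <= y%:E)%E]) p.
    have : closed ([set p : \bar R * \bar R | (p.1 <= m%:E)%E] `|` [set p | (p.2 <= y%:E)%E]).
      apply: closedU.
        exact: (closed_fst_preimage _ _ [set x | (x <= m%:E)%E] (@closed_ereal_ge_ereal R _)).
      exact: (closed_snd_preimage _ _ [set x | (x <= y%:E)%E] (@closed_ereal_ge_ereal R _)).
    move/closure_id => ->; apply: closure_subset clEp => q [_].
    rewrite /corner/= => nq.
    have [mq|/ltW qm] := leP m%:E q.1; last by left.
    have [yq|/ltW qy] := leP y%:E q.2; last by right.
    by case: nq.
  - by left; apply/eqP; rewrite eq_le pm.
  - by right; apply/eqP; rewrite eq_le py.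
move=> [[/= mp yp] pmy].
have Ep : @Espace R p.
  by split; [apply: le_trans mp; rewrite lee_fin ltW|apply: lt_le_trans yp].
split; first by split=> //; exact: subset_closure.
case: p mp yp pmy Ep => p1 p2 /= mp yp [->|->] [/= p10 p20] B pB.
- have c : (x%:E, p2) @[x --> m^'-] --> (m%:E, p2).
    apply: (@cvg_pair _ _ _ _ (nbhs m%:E) (nbhs p2)); last exact: cvg_cst.
    exact/cvg_at_left_filter/EFin_cvg.
  near m^'- => x; exists (x%:E, p2); split; last by near: x; exact: c.
  have x0 : 0 < x by near: x; exact: nbhs_left_gt.
  have xm : x < m by near: x; exact: nbhs_left_lt.
  split; first by split=> //=; rewrite lee_fin ltW.
  by rewrite /corner/= lee_fin => -[]; rewrite leNgt xm.
- have c : (p1, x%:E) @[x --> y^'-] --> (p1, y%:E).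
    apply: (@cvg_pair _ _ _ _ (nbhs p1) (nbhs y%:E)); first exact: cvg_cst.
    exact/cvg_at_left_filter/EFin_cvg.
  near y^'- => x; exists (p1, x%:E); split; last by near: x; exact: c.
  have x0 : 0 < x by near: x; exact: nbhs_left_gt.
  have xy : x < y by near: x; exact: nbhs_left_lt.
  split; first by split=> //=; rewrite lte_fin.
  by rewrite /corner/= lee_fin => -[_]; rewrite leNgt xy.
Unshelve. all: by end_near. Qed.

(** The convergence hypothesis excludes mass on the line at infinity, so far corners are light; null
    slices then provide edges [m] and [z] without mass, making the corner a continuity set. *)
Lemma exists_small_corner (R : realType)
    (mu : {measure set (\bar R * \bar R) -> \bar R}) (y e : R) :
  radon_on mu (@Espace R) ->
  (forall y : R, 0 < y ->
     mu ([set p | (0 <= p.1 <= x%:E)%E] `&` [set p | (y%:E < p.2)%E])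
       @[x --> +oo] -->
     mu ([set p | (0 <= p.1 <= +oo)%E] `&` [set p | (y%:E < p.2)%E])) ->
  0 < y -> 0 < e ->
  exists m z : R, [/\ 0 < m, 0 < z <= y,
    mu (rel_boundary (@Espace R) (corner m z)) = 0%E & (mu (corner m z) < e%:E)%E].
Proof.
move=> [_ mufin] mucvg y0 e0.
have y20 : 0 < y / 2 by exact: divr_gt0.
(* A compact part of [Espace], so of finite mass, that contains the sets measured below; halving [y]
   leaves the room []y / 2, y[] for [z]. *)
pose B : set (\bar R * \bar R) := corner 0 (y / 2).
have mB : measurable B by exact: measurable_corner.
have Boo : (mu B < +oo)%E.
  apply: mufin; first exact: compact_corner.
  by move=> p [p1 p2]; split=> //; apply: lt_le_trans p2; rewrite lte_fin.
have [|z /andP[yz zy] muz] := exists_null_slice _ _ _ mu B snd (y / 2) y mB Boo measurable_snd.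
  by lra.
pose D (x : \bar R) : set (\bar R * \bar R) :=
  [set p | (0 <= p.1 <= x)%E] `&` [set p | ((y / 2)%:E < p.2)%E].
have mD x : measurable (D x).
  apply: measurableI.
    rewrite (_ : [set p | _] = [set p : \bar R * \bar R | `[0%E, x]%classic p.1]).
      by apply: (measurable_fst_preimage _ `[0%E, x]%classic); exact: emeasurable_itv.
    by apply/seteqP; split => p /=; rewrite in_itv.
  rewrite (_ : [set p | _] = [set p : \bar R * \bar R | `](y / 2)%:E, +oo[%classic p.2]).
    by apply: (measurable_snd_preimage _ `](y / 2)%:E, +oo[%classic); exact: emeasurable_itv.
  by apply/seteqP; split => p /=; rewrite in_itv/= andbT.
have DB x : D x `<=` B by move=> p [/andP[p0 _] /ltW yp]; split.
have Dfin x : mu (D x) \is a fin_num.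
  rewrite ge0_fin_numE//; apply: le_lt_trans Boo.
  by apply: le_measure; rewrite ?inE//; exact: DB.
have [m0 m00 hm0] : exists2 m0, 0 < m0 & (mu (D +oo) - mu (D m0%:E) < e%:E)%E.
  have := mucvg _ y20; rewrite -/(D +oo)%E -(fineK (Dfin +oo%E)).
  move=> /fine_cvgP[_ /= /cvgr_gt h].
  near +oo_R => x; exists x => //.
  rewrite -(fineK (Dfin x%:E)) -(fineK (Dfin +oo%E)) -EFinB lte_fin ltrBlDl -ltrBlDr.
  by near: x; apply: h; rewrite ltrBlDr ltrDl.
have [|m /andP[m0m _] mum] :=
  exists_null_slice _ _ _ mu B fst m0 (m0 + 1) mB Boo measurable_fst; first by lra.
have m_gt0 : 0 < m by exact: lt_trans m0m.
have z0 : 0 < z by exact: lt_trans yz.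
have AB : corner m z `<=` B.
  move=> p [/= mp zp]; split=> /=.
    by apply: le_trans mp; rewrite lee_fin ltW.
  by apply: le_trans zp; rewrite lee_fin ltW.
exists m, z; split=> //; first by rewrite z0 ltW.
- rewrite rel_boundary_corner//; apply/eqP; rewrite -measure_le0.
  have mfst : measurable (B `&` fst @^-1` [set m%:E]).
    apply: measurableI => //.
    exact: (measurable_fst_preimage _ [set m%:E]).
  have msnd : measurable (B `&` snd @^-1` [set z%:E]).
    apply: measurableI => //.
    exact: (measurable_snd_preimage _ [set z%:E]).
  rewrite (_ : 0%E = (mu (B `&` fst @^-1` [set m%:E]) + mu (B `&` snd @^-1` [set z%:E]))%E).
    apply: (le_trans _ (measureU2 _ _ _)) => //.
    apply: le_measure; rewrite ?inE//.
    + apply: measurableI; first exact: measurable_corner.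
      apply: measurableU.
        exact: (measurable_fst_preimage _ [set m%:E]).
      exact: (measurable_snd_preimage _ [set z%:E]).
    + exact: measurableU.
    + by move=> p [/AB Bp [pm|pz]]; [left|right].
  by rewrite mum muz adde0.
(* As [m0 < m] and [y / 2 < z], the corner lies in [D +oo] minus [D m0], whose mass is below [e]. *)
- apply: le_lt_trans hm0; rewrite -(setIidr (_ : D m0%:E `<=` D +oo%E)); last first.
    by move=> p [/andP[p0 _] yp]; split; [apply/andP; split; [|exact: leey]|].
  rewrite -measureD//; last by rewrite -ge0_fin_numE ?Dfin.
  apply: le_measure; rewrite ?inE//.
  + exact: measurable_corner.
  + exact: measurableD.
  move=> p [/= mp zp]; split.
    split=> /=; last by apply: lt_le_trans zp; rewrite lte_fin.
    by rewrite leey andbT (le_trans _ mp)// lee_fin ltW.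
  move=> [/andP[_ pm] _].
  by have := le_trans mp pm; rewrite lee_fin leNgt m0m.
Unshelve. all: by end_near. Qed.

(** * From a scaling limit along [a] to regular variation *)

(** Room to perturb a limit [l] into [l * (1 + eta)] and [l * (1 - eta)] within [e], both still
    positive. *)
Lemma exists_small_factor {R : realFieldType} (l e : R) : 0 < l -> 0 < e ->
  exists2 eta, 0 < eta < 1 & l * eta < e.
Proof.
move=> l0 e0; exists (Num.min 2^-1 (e / l / 2)).
  rewrite lt_min invr_gt0 ltr0Sn !divr_gt0//= gt_min; apply/orP; left; lra.
apply: (@le_lt_trans _ _ (e / 2)); last by lra.
by rewrite mulrC -ler_pdivlMr// ge_min mulrAC lexx orbT.
Qed.

(* Along [t = (H x)^-1], which tends to infinity, [t * H x = 1], so [x / a t] tends to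
   [C `^ p^-1]; hence [H (s * x) / H x = t * H (s * x)] tends to [s `^ (- p)]. *)
Lemma RV_of_tail_scaling {R : realType} (H a : R -> R) (p C : R) :
  0 < p -> 0 < C -> (forall x, 0 <= H x) -> nonincreasing_fun H ->
  (forall t, 0 < t -> 0 < a t) ->
  (forall z, 0 < z -> t * H (z * a t) @[t --> +oo] --> C * z `^ (- p)) ->
  RV (- p) H.
Proof.
move=> p0 C0 H_ge0 Hni a0 Hlim.
have limgt0 z : 0 < z -> \forall t \near +oo, 0 < H (z * a t).
  move=> z0; near=> t; have t0 : 0 < t by [].
  rewrite -(pmulr_rgt0 _ t0); near: t; apply: (cvgr_gt _ (Hlim z z0)).
  by rewrite mulr_gt0// powR_gt0.
have Hsmall e : 0 < e -> \forall t \near +oo, H (a t) < e.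
  move=> e0; near=> t; have t0 : 0 < t by [].
  rewrite -(ltr_pM2l t0); apply: (@lt_trans _ _ (C + 1)).
    near: t; have := Hlim 1 ltr01; rewrite powR1 mulr1 => /cvgr_lt.
    move=> /(_ (C + 1)); rewrite ltrDl => /(_ ltr01).
    by under eq_near do rewrite mul1r.
  by rewrite -ltr_pdivrMr//; near: t; apply: nbhs_pinfty_gt; exact: num_real.
have H_gt0 x : 0 < x -> 0 < H x.
  move=> x0; rewrite lt_neqAle H_ge0 andbT eq_sym; apply/eqP => Hx.
  (* If [H x = 0], then [a t > y] would force [H (x / y * a t) = 0], which fails for large [t]. So
     [a t <= y] eventually, and [H y <= H (a t)] is arbitrarily small; but [H] cannot vanish on all
     of []0, +oo[], by [limgt0] at 1. *)
  have Hy y : 0 < y -> H y <= 0.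
    move=> y0; apply/ler_addgt0Pl => e e0; rewrite addr0.
    near +oo_R => t; have t0 : 0 < t by [].
    have aty : a t <= y.
      rewrite leNgt; apply/negP => yat.
      have : H (x / y * a t) <= H x.
        by apply/Hni; rewrite mulrAC ler_pdivlMr// ler_pM2l// ltW.
      rewrite Hx leNgt => /negP; apply.
      by near: t; apply: limgt0; exact: divr_gt0.
    apply: (le_trans (Hni _ _ aty)); apply: ltW.
    by near: t; exact: Hsmall.
  near +oo_R => t; have t0 : 0 < t by [].
  have : 0 < H (1 * a t) by near: t; exact: limgt0.
  by rewrite ltNge mul1r Hy// a0.
have Hoo : (H x)^-1 @[x --> +oo] --> +oo.
  apply/gtr0_cvgV0.
    near=> x; rewrite invr_gt0 H_gt0//.
  apply/cvgr0Pnorm_lt => e e0; near +oo_R => t.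
  have Hat : H (a t) < e by near: t; exact: Hsmall.
  near=> x; rewrite /= invrK ger0_norm//; apply: le_lt_trans Hat; exact/Hni.
split; first exact: H_gt0.
split; first by apply: nonincreasing_measurable; [exact: measurableT|exact/Hni].
move=> s s0.
(* [z q] is the scale at which the limit in [Hlim] equals [q]; values of [q] on either side of 1
   trap [x] between two multiples of [a (H x)^-1]. *)
pose z q := (C / q) `^ p^-1.
have zgt0 q : 0 < q -> 0 < z q by move=> q0; rewrite powR_gt0// divr_gt0.
have zE q : 0 < q -> C * z q `^ (- p) = q.
  move=> q0; rewrite /z -powRrM mulrN mulVf ?gt_eqF// powR_inv1 ?divr_ge0 ?ltW//.
  by rewrite invf_div mulrCA divff ?mulr1 ?gt_eqF.
have zsE q : 0 < q -> C * (s * z q) `^ (- p) = s `^ (- p) * q.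
  by move=> q0; rewrite powRM ?ltW ?zgt0// mulrCA zE.
have Hlim' w : 0 < w -> (H x)^-1 * H (w * a (H x)^-1) @[x --> +oo] --> C * w `^ (- p).
  by move=> w0; exact: (cvg_comp _ _ Hoo (Hlim w w0)).
have sp0 : 0 < s `^ (- p) by rewrite powR_gt0.
(* With [t = (H x)^-1] and [q > 1], eventually [H (z q * a t) > H x], so monotonicity gives
   [z q * a t <= x]; evaluating [H] at [s] times both sides bounds the ratio from above. *)
have up q v : 1 < q -> s `^ (- p) * q < v ->
    \forall x \near +oo, H (s * x) / H x < v.
  move=> q1 qv; have q0 := lt_trans ltr01 q1.
  near=> x; have Hx0 : 0 < H x by rewrite H_gt0.
  apply: (@le_lt_trans _ _ ((H x)^-1 * H (s * z q * a (H x)^-1))); last first.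
    near: x; apply: (cvgr_lt _ (Hlim' _ _)); last by rewrite zsE.
    by rewrite mulr_gt0 ?zgt0.
  rewrite mulrC ler_pM2l ?invr_gt0//; apply/Hni.
  rewrite -mulrA ler_pM2l//.
  have : 1 < (H x)^-1 * H (z q * a (H x)^-1).
    by near: x; apply: (cvgr_gt _ (Hlim' _ (zgt0 _ q0))); rewrite zE.
  apply: contraTT; rewrite -ltNge => /ltW/Hni; rewrite -leNgt => h.
  by rewrite mulrC ler_pdivrMr// mul1r.
(* The mirror argument: for [q < 1], eventually [x <= z q * a t]. *)
have lo q v : 0 < q -> q < 1 -> v < s `^ (- p) * q ->
    \forall x \near +oo, v < H (s * x) / H x.
  move=> q0 q1 qv.
  near=> x; have Hx0 : 0 < H x by rewrite H_gt0.
  apply: (@lt_le_trans _ _ ((H x)^-1 * H (s * z q * a (H x)^-1))).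
    near: x; apply: (cvgr_gt _ (Hlim' _ _)); last by rewrite zsE.
    by rewrite mulr_gt0 ?zgt0.
  rewrite mulrC ler_pM2r ?invr_gt0//; apply/Hni.
  rewrite -mulrA ler_pM2l//.
  have : (H x)^-1 * H (z q * a (H x)^-1) < 1.
    by near: x; apply: (cvgr_lt _ (Hlim' _ (zgt0 _ q0))); rewrite zE.
  apply: contraTT; rewrite -ltNge => /ltW/Hni; rewrite -leNgt => h.
  by rewrite mulrC ler_pdivlMr// mul1r.
apply/cvgrPdist_lt => e e0.
have [eta /andP[eta0 eta1] etae] := exists_small_factor _ _ sp0 e0.
near=> x; rewrite distrC ltr_distl; apply/andP; split; near: x.
- by apply: (lo (1 - eta)); lra.
- by apply: (up (1 + eta)); lra.
Unshelve. all: by end_near. Qed.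


(** * Decay along powers of 2 and the passage to a continuous parameter *)

Lemma cvg_pow2_pinfty {R : realType} : (2 : R) ^+ n @[n --> \oo] --> +oo.
Proof.
apply/cvgryPge => A; near=> n.
apply: (@le_trans _ _ n%:R); last by rewrite -natrX ler_nat ltnW// ltn_expl.
by near: n; exact: nbhs_infty_ger.
Unshelve. all: by end_near. Qed.

(** Consecutive dyadic values have a ratio tending to 2 to the power [rho], which is below 1; with
    [r] the midpoint between this limit and 1, they decay geometrically. *)
Lemma RV_dyadic_cvg0 {R : realType} (rho : R) (alpha : R -> R) :
  rho < 0 -> RV rho alpha -> alpha (2 ^+ n) @[n --> \oo] --> 0.
Proof.
move=> rho0 [alpha0 [_ /(_ 2) alpha2]].
have {}alpha2 := alpha2 (ltr0Sn _ _).
have rho1 : 2 `^ rho < 1.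
  rewrite /powR pnatr_eq0/= expR_lt1 nmulr_rlt0// ln_gt0//.
  by rewrite ltr1n.
pose r := (2 `^ rho + 1) / 2.
have r0 : 0 < r by rewrite divr_gt0// addr_gt0// powR_gt0.
have r1 : r < 1 by rewrite /r; lra.
have rr : 2 `^ rho < r by rewrite /r; lra.
have pow2oo := @cvg_pow2_pinfty R.
have [N _ hN] : \forall n \near \oo, alpha (2 * 2 ^+ n) / alpha (2 ^+ n) < r.
  exact: (pow2oo _ (cvgr_lt _ alpha2 _ rr)).
have bnd k : alpha (2 ^+ (k + N)) <= r ^+ k * alpha (2 ^+ N).
  elim: k => [|k ih]; first by rewrite expr0 mul1r.
  have := hN (k + N)%N (leq_addl _ _).
  rewrite ltr_pdivrMr ?alpha0 ?exprn_gt0// -exprS => /ltW h.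
  apply: (le_trans h); rewrite exprS -mulrA ler_pM2l//.
rewrite -(cvg_shiftn N); apply: (@squeeze_cvgr _ _ _ _ (cst 0) (fun k => r ^+ k * alpha (2 ^+ N))).
- near=> k; rewrite bnd andbT ltW// alpha0// exprn_gt0//.
- exact: cvg_cst.
- rewrite -[X in _ --> X](mul0r (alpha (2 ^+ N))); apply: cvgMl.
  by apply: cvg_expr; rewrite ger0_norm// ltW.
Unshelve. all: by end_near. Qed.

(* With [c `^ (- p) = 2], [a t < c * a s] would give [s * G (c * a s) <= t * G (a t)],
   whose sides tend to 2 and 1. *)
Lemma scale_almost_nondecreasing {R : realType} (G a : R -> R) (p : R) :
  0 < p -> (forall x, 0 <= G x) -> nonincreasing_fun G ->
  (forall z, 0 < z -> t * G (z * a t) @[t --> +oo] --> z `^ (- p)) ->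
  exists2 c : R, 0 < c &
    exists t0 : R, forall s t, t0 <= s -> s <= t -> c * a s <= a t.
Proof.
move=> p0 G0 Gni Glim; pose c := (2^-1 : R) `^ p^-1.
have c0 : 0 < c by rewrite powR_gt0.
have cE : c `^ (- p) = 2.
  by rewrite /c -powRrM mulrN mulVf ?gt_eqF// powR_inv1// invrK.
exists c => //.
(* [3 / 2] separates the limits 2 and 1. *)
have [t1 [_ ht1]] : \forall t \near +oo, 3 / 2 < t * G (c * a t).
  by apply: (cvgr_gt _ (Glim _ c0)); rewrite cE; lra.
have [t2 [_ ht2]] : \forall t \near +oo, t * G (a t) < 3 / 2.
  have := Glim 1 ltr01; under eq_cvg do rewrite mul1r.
  by move/cvgr_lt; apply; rewrite powR1; lra.
(* The added 1 makes [s] exceed the thresholds strictly, as neighbourhoods of [+oo] require. *)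
exists (Num.max 0 (Num.max t1 t2) + 1) => s t t0s st.
have [s0 s1 s2] : [/\ 0 < s, t1 < s & t2 < s].
  by split; apply: lt_le_trans t0s; rewrite ltr_pwDr// !le_max lexx ?orbT.
rewrite leNgt; apply/negP => /ltW/Gni h.
have : 3 / 2 < 3 / 2 :> R; last by rewrite ltxx.
apply: (lt_trans (ht1 _ s1)); apply: le_lt_trans (ht2 _ (lt_le_trans s2 st)).
by apply: ler_pM => //; exact: ltW.
Qed.

(** For [2 ^ k <= t <= 2 * 2 ^ k], monotonicity of [N] and [c * a (2 ^ k) <= a t] bound the quantity
    at [t] by twice the dyadic one, with [y * c] in place of [y]. *)
Lemma cvg0_of_dyadic {R : realType} (N a : R -> R) (c t0 : R) :
  (forall x, 0 <= N x) -> nonincreasing_fun N -> 0 < c ->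
  (forall s t, t0 <= s -> s <= t -> c * a s <= a t) ->
  (forall y, 0 < y -> 2 ^+ n * N (y * a (2 ^+ n)) @[n --> \oo] --> 0) ->
  forall y, 0 < y -> t * N (y * a t) @[t --> +oo] --> 0.
Proof.
move=> N0 Nni c0 ca Nlim y y0; apply/cvgr0Pnorm_lt => e e0.
have [n1 _ hn1] : \forall n \near \oo, 2 ^+ n * N (y * c * a (2 ^+ n)) < e / 2.
  by apply: (cvgr_lt _ (Nlim _ (mulr_gt0 y0 c0))); exact: divr_gt0.
(* Once [2 ^ n0 <= t], the largest power [2 ^ k] not exceeding [t] satisfies both [n1 <= k] and
   [t0 <= 2 ^ k]. *)
pose n0 := maxn n1 (Num.truncn t0).+1.
near=> t.
have tn0 : 2 ^+ n0 <= t by near: t; apply: nbhs_pinfty_ge; exact: num_real.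
have t_gt0 : 0 < t by apply: lt_le_trans tn0; exact: exprn_gt0.
pose m := Num.truncn t; have /andP[mt tm] : m%:R <= t < m.+1%:R.
  by apply: truncn_itv; exact: ltW.
have n0m : (2 ^ n0 <= m)%N by rewrite /m truncn_ge_nat ?natrX// ltW.
have m0 : (0 < m)%N by apply: leq_trans n0m; rewrite expn_gt0.
(* The logarithm is that of the integer part [m]; since [t < m + 1] and [m + 1 <= 2 ^ k.+1], the
   upper bound on [t] survives the truncation. *)
pose k := trunc_log 2 m.
have /andP[km mk] := trunc_log_bounds (isT : 1 < 2)%N m0; rewrite -/k in km mk.
have kt : 2 ^+ k <= t by apply: le_trans mt; rewrite -natrX ler_nat.
have tk : t <= 2 * 2 ^+ k.
  by rewrite ltW// -exprS -natrX (lt_le_trans tm)// ler_nat.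
have n0k : (n0 <= k)%N by exact: trunc_log_max.
have t0k : t0 <= 2 ^+ k.
  apply/ltW/(lt_le_trans (truncnS_gt t0)).
  rewrite -natrX ler_nat (@leq_trans k)//; last by rewrite ltnW// ltn_expl.
  by rewrite (leq_trans _ n0k)// leq_maxr.
have n1k : (n1 <= k)%N by rewrite (leq_trans _ n0k)// leq_maxl.
have {}hn1 := hn1 k n1k.
rewrite ger0_norm; last by rewrite mulr_ge0 ?(ltW t_gt0).
apply: (@le_lt_trans _ _ (2 * 2 ^+ k * N (y * c * a (2 ^+ k)))).
  apply: ler_pM; [exact: ltW|exact: N0|exact: tk|].
  by apply: Nni; rewrite -mulrA ler_pM2l// ca.
by rewrite -mulrA mulrC -ltr_pdivlMr.
Unshelve. all: by end_near. Qed.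

(** * Tails of random variables and their rescaling *)

Lemma upper_endpoint_gt {d} {T : measurableType d} {R : realType}
    (P : probability T R) (X : T -> R) (b : R) :
  (upper_endpoint P X < b%:E)%E -> P [set w | b < X w] = 0%E.
Proof.
move=> Xb; apply/eqP; rewrite eq_le measure_ge0 andbT leNgt; apply/negP => Pb.
by move: Xb; rewrite ltNge => /negP; apply; apply: ereal_sup_ubound; exists b.
Qed.

(** A relative error [q] in the limit is realised exactly by moving the bound [b] on [X]. *)
Lemma powR_div_factor (R : realType) (z b q p : R) :
  0 < z -> 0 < b -> 0 < q -> 0 < p ->
  (z / (b * q `^ p^-1)) `^ (- p) = z `^ (- p) * b `^ p * q.
Proof.
move=> z0 b0 q0 p0.
have bq0 : 0 < b * q `^ p^-1 by rewrite mulr_gt0// powR_gt0.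
rewrite powRM ?invr_ge0 1?ltW// -mulrA; congr (_ * _).
rewrite -powR_inv1 1?ltW// -powRrM mulrNN mul1r powRM ?powR_ge0 1?ltW//.
by rewrite -powRrM mulVf ?gt_eqF// powRr1// ltW.
Qed.

Section tail_scaling.
Context {d} {T : measurableType d} {R : realType} (P : probability T R).
Implicit Types f g : T -> R.

Lemma measurable_gt f (v : R) : measurable_fun setT f ->
  measurable [set w | v < f w].
Proof.
move=> mf; rewrite -[X in measurable X]setTI -preimage_itvoy.
by apply: mf => //; exact: measurable_itv.
Qed.

Lemma measurable_ge f (v : R) : measurable_fun setT f ->
  measurable [set w | v <= f w].
Proof.
move=> mf; rewrite -[X in measurable X]setTI -preimage_itvcy.
by apply: mf => //; exact: measurable_itv.
Qed.

Lemma measurable_le f (v : R) : measurable_fun setT f ->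
  measurable [set w | f w <= v].
Proof.
move=> mf; rewrite -[X in measurable X]setTI -preimage_itvNyc.
by apply: mf => //; exact: measurable_itv.
Qed.

Lemma le_fine_measure A B : measurable A -> measurable B -> A `<=` B ->
  fine (P A) <= fine (P B).
Proof.
move=> mA mB AB; apply: fine_le; rewrite ?fin_num_measure//.
by apply: le_measure; rewrite ?inE.
Qed.

Lemma nonincreasing_tail f : measurable_fun setT f ->
  nonincreasing_fun (fun v => fine (P [set w | v < f w])).
Proof.
move=> mf u v uv; apply: le_fine_measure; try exact: measurable_gt.
by move=> w /=; exact: le_lt_trans.
Qed.

Lemma cvg_fine_measure (S : R -> set T) (l : R) : (forall t, measurable (S t)) ->
  (t%:E * P (S t))%E @[t --> +oo] --> l%:E <->
  t * fine (P (S t)) @[t --> +oo] --> l.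
Proof.
move=> mS.
have -> : (fun t => t%:E * P (S t))%E = EFin \o (fun t => t * fine (P (S t))).
  by apply/funext => t /=; rewrite EFinM fineK// fin_num_measure.
rewrite fine_cvgP; split => [[]//|h]; split=> //; exact: nearW.
Qed.

(** Dividing by [a t] preserves the event when [a t > 0], hence for all [t > 0], which suffices at
    [+oo]. *)
Lemma cvg_scaled_tail f (a : R -> R) (z l : R) : measurable_fun setT f ->
  (forall t, 0 < t -> 0 < a t) ->
  (t%:E * P [set w | (z < f w / a t)%R])%E @[t --> +oo] --> l%:E <->
  t * fine (P [set w | z * a t < f w]) @[t --> +oo] --> l.
Proof.
move=> mf a0; rewrite cvg_fine_measure; last first.
  by move=> t; apply: measurable_gt; exact: measurable_funM.
have E : \forall t \near +oo, t * fine (P [set w | z < f w / a t]) =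
    t * fine (P [set w | z * a t < f w]).
  near=> t; have t0 : 0 < t by [].
  congr (_ * fine (P _)); apply/seteqP; split=> w /=; by rewrite ltr_pdivlMr// a0.
split; apply: cvg_trans; apply: near_eq_cvg => //.
by near=> t; apply/esym; near: t.
Unshelve. all: by end_near. Qed.

End tail_scaling.

(** * Sandwiching the tail of [X Y] between tails of [Y] *)

Theorem theorem5p11 (d : measure_display) (T : measurableType d)
  (R : realType) (P : probability T R) (X Y : {RV P >-> R})
  (rho gamma beta : R) (alpha a : R -> R)
  (mu : {measure set (\bar R * \bar R) -> \bar R}) :
  rho < 0 -> 0 < gamma ->
  (forall w, 0 <= X w) -> (forall w, 0 <= Y w) ->
  upper_endpoint P X = beta%:E -> 0 < beta ->
  RV rho alpha -> RV gamma a ->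
  (forall y : R, 0 < y ->
     (t%:E * P [set w | (y < Y w / a t)%R])%E @[t --> +oo]
       --> (y `^ (- gamma^-1))%:E) ->
  radon_on mu (@Espace R) -> mu setT <> 0%E ->
  vague_cvg (@Espace R)
    (fun t A => (t%:E * P [set w | A (((beta - X w) / alpha t)%R%:E,
                                      (Y w / a t)%R%:E)])%E) mu ->
  (forall y : R, 0 < y ->
     nondeg_distribution_fun
       (fun x : \bar R => mu ([set p | (0 <= p.1 <= x)%E] `&`
                              [set p | (y%:E < p.2)%E]))) ->
  RV (- gamma^-1) (fun x => fine (P [set w | x < X w * Y w])) /\
  forall z : R, 0 < z ->
    (t%:E * P [set w | (z < X w * Y w / a t)%R])%E @[t --> +oo]
      --> (z `^ (- gamma^-1) * beta `^ (gamma^-1))%:E.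
Proof.
move=> rho0 gamma0 X0 Y0 Xbeta beta0 alphaRV [a0 _] Ytail mu_radon _ muX munondeg.
set p := gamma^-1; have p0 : 0 < p by rewrite invr_gt0.
have mX : measurable_fun setT X by exact: measurable_funPT.
have mY : measurable_fun setT Y by exact: measurable_funPT.
have mXY : measurable_fun setT (fun w => X w * Y w) by exact: measurable_funM.
pose G v := fine (P [set w | v < Y w]).
pose H v := fine (P [set w | v < X w * Y w]).
pose N b v := fine (P [set w | X w <= b /\ v < Y w]).
have mN b v : measurable [set w | X w <= b /\ v < Y w].
  by apply: measurableI; [exact: measurable_le|exact: measurable_gt].
have Glim z : 0 < z -> t * G (z * a t) @[t --> +oo] --> z `^ (- p).
  by move=> z0; apply/cvg_scaled_tail => //; exact: Ytail.
have Ndyadic b y : b < beta -> 0 < y ->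
    2 ^+ n * N b (y * a (2 ^+ n)) @[n --> \oo] --> 0.
  move=> bbeta y0; apply/cvgr0Pnorm_lt => e e0.
  (* [X <= b] forces [(beta - X) / alpha (2 ^+ n)] beyond any fixed [m], as
     [alpha (2 ^+ n) --> 0]. *)
  have [|m [z [m0 /andP[z0 zy] bd0 mue]]] := exists_small_corner _ mu y e mu_radon _ y0 e0.
    (* The fourth clause of nondegeneracy is the absence of mass at infinity in the first
       coordinate. *)
    by move=> v v0; have [_ _ _ + _] := munondeg v v0; exact.
  have cE : corner m z `<=` @Espace R.
    move=> q [/= q1 q2]; split; first by apply: le_trans q1; rewrite lee_fin ltW.
    by apply: lt_le_trans q2; rewrite lte_fin.
  have cK : rel_compact (@Espace R) (corner m z).
    by exists (corner m z); split=> //; exact: compact_corner.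
  (* The open ray below [e] is a neighbourhood of the limit mass, so the rescaled mass of the corner
     is eventually below [e]. *)
  have /(_ [set x | (x < e%:E)%E]) h := muX _ (measurable_corner _ m z) cE cK bd0.
  have {}h := h (open_nbhs_nbhs (conj (@open_ereal_lt_ereal _ _) mue)).
  have pow2oo : (2 : R) ^+ n @[n --> \oo] --> +oo by exact: cvg_pow2_pinfty.
  have {}h := pow2oo _ h.
  near=> n; have a2 : 0 < a (2 ^+ n) by rewrite a0// exprn_gt0.
  have al2 : 0 < alpha (2 ^+ n) by apply: (proj1 alphaRV); rewrite exprn_gt0.
  rewrite ger0_norm ?mulr_ge0 ?fine_ge0// -lte_fin.
  have : ((2 ^+ n)%:E * P [set w | corner m z (((beta - X w) / alpha (2 ^+ n))%R%:E,
      (Y w / a (2 ^+ n))%R%:E)] < e%:E)%E by near: n; exact: h.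
  apply: le_lt_trans; rewrite EFinM fineK ?fin_num_measure//.
  apply: lee_wpmul2l; first by rewrite lee_fin.
  apply: le_measure; rewrite ?inE//.
    have mX' := @measurable_ge _ _ _ (fun w => (beta - X w) / alpha (2 ^+ n)) m.
    have mY' := @measurable_ge _ _ _ (fun w => Y w / a (2 ^+ n)) z.
    apply: (measurableI _ _ (mX' _) (mY' _)); apply: measurable_funM => //.
    exact: measurable_funB.
  have alb : alpha (2 ^+ n) < (beta - b) / m.
    near: n; apply: (cvgr_lt _ (RV_dyadic_cvg0 _ _ rho0 alphaRV)).
    by rewrite divr_gt0// subr_gt0.
  move=> w [/= Xb Yw]; split; rewrite /= lee_fin.
    rewrite ler_pdivlMr// mulrC -ler_pdivlMr//.
    by rewrite (le_trans (ltW alb))// ler_pM2r ?invr_gt0// lerB.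
  by rewrite ler_pdivlMr// (le_trans _ (ltW Yw))// ler_pM2r.
have [c c0 [t0 ca]] := scale_almost_nondecreasing G a p p0 (fun v => fine_ge0 (measure_ge0 P _))
  (nonincreasing_tail P Y mY) Glim.
have Nlim b y : b < beta -> 0 < y -> t * N b (y * a t) @[t --> +oo] --> 0.
  move=> bbeta y0; apply: (cvg0_of_dyadic (N b) a c t0) => //.
  - by move=> x; exact/fine_ge0.
  - move=> u v uv; apply: le_fine_measure => //.
    by move=> w [/= Xb vY]; split=> //; exact: le_lt_trans uv vY.
  - by move=> v v0; exact: Ndyadic.
(* For [b > beta] the event [X > b] is null, so outside a null set [X Y > v] forces [Y > v / b]. *)
have up b v : beta < b -> H v <= G (v / b).
  move=> betab; have b0 : 0 < b by exact: lt_trans betab.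
  have PX0 : P [set w | b < X w] = 0%E.
    by apply: upper_endpoint_gt; rewrite Xbeta lte_fin.
  rewrite /H /G -[leRHS]add0r -[in leRHS](_ : fine (P [set w | b < X w]) = 0); last first.
    by rewrite PX0.
  rewrite -fineD ?fin_num_measure//; try exact: measurable_gt.
  apply: fine_le; rewrite ?fin_numD ?fin_num_measure//; try exact: measurable_gt.
  apply: le_trans (measureU2 _ _ _); try exact: measurable_gt.
  apply: le_measure; rewrite ?inE//; try exact: measurable_gt.
    by apply: measurableU; exact: measurable_gt.
  move=> w /= vXY; have [Xb|bX] := leP (X w) b; [right|by left].
  by rewrite ltr_pdivrMr// (lt_le_trans vXY)// mulrC ler_wpM2l.
(* Where [X > b], [Y > v / b] yields [X Y > v]; the rest is counted by [N], negligible for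
   [b < beta] by [Nlim]. *)
have lo b v : 0 < b -> G (v / b) <= H v + N b (v / b).
  move=> b0; rewrite /H /G /N -fineD ?fin_num_measure//; try exact: measurable_gt.
  apply: fine_le; rewrite ?fin_numD ?fin_num_measure//; try exact: measurable_gt.
  apply: le_trans (measureU2 _ _ _) => //; try exact: measurable_gt.
  apply: le_measure; rewrite ?inE//; try exact: measurable_gt.
    by apply: measurableU => //; exact: measurable_gt.
  move=> w /= vbY; have [Xb|bX] := leP (X w) b; [by right|left] => /=.
  have Yw0 : 0 <= Y w by [].
  by move: vbY; rewrite ltr_pdivrMr// => /lt_le_trans; apply; rewrite mulrC ler_wpM2r// ltW.
have Hlim z : 0 < z -> t * H (z * a t) @[t --> +oo] --> beta `^ p * z `^ (- p).
  move=> z0; rewrite mulrC; set l := _ * _.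
  have l0 : 0 < l by rewrite mulr_gt0// powR_gt0.
  apply/cvgrPdist_lt => e e0.
  have [eta /andP[eta0 eta1] etae] := exists_small_factor _ _ l0 e0.
  (* [b2 < beta < b1] are chosen so that the lower and upper bounds tend exactly to [l * (1 - eta)]
     and [l * (1 + eta)], both within [e] of [l]. *)
  pose q1 := 1 + eta; pose b1 := beta * q1 `^ p^-1.
  pose q2 := 1 - eta; pose b2 := beta * q2 `^ p^-1.
  have q20 : 0 < q2 by rewrite subr_gt0.
  have oneE : (1 : R) `^ p^-1 = 1 by rewrite powR1.
  have b1beta : beta < b1.
    rewrite ltr_pMr// -[ltLHS]oneE gt0_ltr_powR ?invr_gt0// ?nnegrE//.
      by rewrite /q1; lra.
    by rewrite /q1; lra.
  have b2beta : b2 < beta.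
    rewrite gtr_pMr// -[ltRHS]oneE gt0_ltr_powR ?invr_gt0// ?nnegrE//.
      exact: ltW.
    by rewrite /q2; lra.
  have b10 : 0 < b1 by exact: lt_trans b1beta.
  have b20 : 0 < b2 by rewrite mulr_gt0// powR_gt0.
  have zb1 : (z / b1) `^ (- p) = l * q1.
    by apply: powR_div_factor => //; rewrite /q1; lra.
  have zb2 : (z / b2) `^ (- p) = l * q2 by exact: powR_div_factor.
  near=> t; have t_gt0 : 0 < t by [].
  rewrite distrC ltr_distl; apply/andP; split.
    apply: (@lt_le_trans _ _ (t * G (z / b2 * a t) - t * N b2 (z / b2 * a t))).
      near: t; apply: (cvgr_gt (l * q2)); last by rewrite /q2; lra.
      rewrite -[X in _ --> X]subr0 -zb2; apply: cvgB.
        by apply: Glim; exact: divr_gt0.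
      by apply: Nlim => //; exact: divr_gt0.
    rewrite -mulrBr ler_pM2l// lerBlDr mulrAC; exact: lo.
  apply: (@le_lt_trans _ _ (t * G (z / b1 * a t))).
    by rewrite ler_pM2l// mulrAC; exact: up.
  near: t; apply: (cvgr_lt (l * q1)); last by rewrite /q1; lra.
  by rewrite -zb1; apply: Glim; exact: divr_gt0.
split.
  apply: (RV_of_tail_scaling H a p (beta `^ p)) => //.
  - by rewrite powR_gt0.
  - by move=> x; exact/fine_ge0.
  - exact: nonincreasing_tail.
move=> z z0; apply/cvg_scaled_tail => //.
by rewrite mulrC; exact: Hlim.
Unshelve. all: by end_near. Qed.
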